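(* Let $\alpha_1,\alpha_2\in(0,1)$, $\lambda_1,\lambda_2>0$, $c_1,c_2\ge 0$ with $c_1+c_2=1$, and let $S_{\alpha_1,\lambda_1,\alpha_2,\lambda_2}(t)$ be the mixture tempered stable subordinator (MTSS). Then for every $0<p<1$, $$\mathbb{E}\big(S_{\alpha_1,\lambda_1,\alpha_2,\lambda_2}(t)\big)^p\sim\big(c_1\alpha_1\lambda_1^{\alpha_1-1}+c_2\alpha_2\lambda_2^{\alpha_2-1}\big)^p\,t^p\quad\text{as }t\to\infty .$$
   Context: The mixture tempered stable subordinator (MTSS) $S_{\alpha_1,\lambda_1,\alpha_2,\lambda_2}(t)$, $t\ge0$, is the nondecreasing Lévy process with Laplace transform $$\mathbb{E}\big(e^{-sS_{\alpha_1,\lambda_1,\alpha_2,\lambda_2}(t)}\big)=\exp\Big(-t\big(c_1((s+\lambda_1)^{\alpha_1}-\lambda_1^{\alpha_1})+c_2((s+\lambda_2)^{\alpha_2}-\lambda_2^{\alpha_2})\big)\Big),\quad s>0 .$$ Here $\mathbb{E}(X)^p$ means the $p$-th moment $\mathbb{E}[X^p]$, and $a(t)\sim b(t)$ means $a(t)/b(t)\to1$. *)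

(* Defs.v *)
From HB Require Import structures.
From mathcomp Require Import all_boot all_order all_algebra.
From mathcomp Require Import all_classical all_reals all_analysis.

Set Implicit Arguments.
Unset Strict Implicit.
Unset Printing Implicit Defensive.

Import Order.TTheory GRing.Theory Num.Theory.
Import numFieldNormedType.Exports.

Local Open Scope classical_set_scope.
Local Open Scope ring_scope.

(* Since the family is finite and [A i = setT] is allowed, the product rule for
   all subfamilies is included. *)
Definition mutually_independent (d : measure_display) (T : measurableType d)
    (R : realType) (P : probability T R) (I : finType) (X : I -> T -> R) : Prop :=
  forall A : I -> set R, (forall i, measurable (A i)) ->
    P [set w | forall i, A i (X i w)] = (\prod_i P (X i @^-1` A i))%E.

(* Quantifying over measurable sets only matters: a measure is a total function
   on [set T] whose values outside the sigma-algebra are meaningless. *)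
Definition same_law (d : measure_display) (T : measurableType d)
    (R : realType) (P : probability T R) (X Y : T -> R) : Prop :=
  forall A : set R, measurable A -> P (X @^-1` A) = P (Y @^-1` A).

(* Processes are indexed by [R], but only the times [0 <= t] are constrained.
   Continuity is in probability; path regularity (cadlag) is not required, so
   that every modification of a Levy process is covered. *)
Record levy_process (d : measure_display) (T : measurableType d)
    (R : realType) (P : probability T R) (S : R -> {RV P >-> R}) : Prop := {
  levy_start0 : {ae P, forall w, S 0 w = 0} ;
  levy_independent_increments : forall (n : nat) (t : nat -> R),
    0 <= t 0%N -> (forall i, t i <= t i.+1) ->
    mutually_independent P (fun (i : 'I_n) w => S (t i.+1) w - S (t i) w) ;
  levy_stationary_increments : forall s t : R, 0 <= s -> 0 <= t ->
    same_law P (fun w => S (s + t) w - S s w) (S t) ;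
  levy_stochastically_continuous : forall s e : R, 0 <= s -> 0 < e ->
    P [set w | e < `|S t w - S s w|]
      @[t --> within [set t | 0 <= t] (nbhs s)] --> 0%E }.

Definition subordinator (d : measure_display) (T : measurableType d)
    (R : realType) (P : probability T R) (S : R -> {RV P >-> R}) : Prop :=
  levy_process S /\
  forall s t : R, 0 <= s -> s <= t -> {ae P, forall w, S s w <= S t w}.

Definition MTSS (d : measure_display) (T : measurableType d)
    (R : realType) (P : probability T R)
    (alpha1 lambda1 alpha2 lambda2 c1 c2 : R) (S : R -> {RV P >-> R}) : Prop :=
  subordinator S /\
  forall t s : R, 0 <= t -> 0 < s ->
    ('E_P[fun w => (expR (- s * S t w))%R])%E =
      (expR (- t * (c1 * ((s + lambda1) `^ alpha1 - lambda1 `^ alpha1) +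
                    c2 * ((s + lambda2) `^ alpha2 - lambda2 `^ alpha2))))%:E.

(* On negative arguments [x `^ p] is a junk value; the processes considered
   here are almost surely nonnegative. *)
Definition moment (d : measure_display) (T : measurableType d)
    (R : realType) (P : probability T R) (p : R) (X : T -> R) : \bar R :=
  ('E_P[fun w => (X w `^ p)%R])%E.

(* The left-hand side is extended-real valued, as moments may a priori be
   infinite: convergence to 1 forces it to be eventually finite. *)
Definition asymp_equiv (R : realType) (a : R -> \bar R) (b : R -> R) : Prop :=
  (a t * ((b t)^-1)%:E)%E @[t --> +oo%R] --> 1%E.

(* Main.v *)
Require Import Defs.
From HB Require Import structures.
From mathcomp Require Import all_boot all_order all_algebra.
From mathcomp Require Import all_classical all_reals all_analysis measurable_realfun.
From mathcomp Require Import ring lra.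

Import Order.TTheory GRing.Theory Num.Theory.
Import numFieldNormedType.Exports.

Local Open Scope classical_set_scope.
Local Open Scope ring_scope.

(* Let m be the derivative at 0 of the Laplace exponent phi, Y = S t / (m t) and
   L(u) = E exp(-uY) = exp(-t phi(u/(mt))).  Concavity gives phi(s) <= m s, hence
   (1 - L(u)) / u <= 1, so E Y <= 1 by Fatou as u -> 0, and E Y^p <= 1 by the
   tangent inequality y^p <= 1 + p(y - 1).
   Conversely w = (1 - exp(-uY)) / u <= Y and w^p >= w + (1 - p) w (1 - w), whose
   expectation is a combination of L(u) and L(2u); since phi(s) >= m s - K s^2,
   taking u = 1/t gives E Y^p >= 1 - C/t. *)

(** * Elementary inequalities for exponentials and powers *)

Lemma oneBexpRN_le {R : realType} (v : R) : 1 - expR (- v) <= v.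
Proof. by have := expR_ge1Dx (- v); lra. Qed.

(** Since [expR v >= 1 + v], the left-hand defect [1 - expR (- v)] is at least [v / (1 + v)], which
    dominates [v - v ^+ 2]. *)
Lemma oneBexpRN_ge {R : realType} (v : R) : 0 <= v ->
  v - v ^+ 2 <= 1 - expR (- v).
Proof.
move=> v0; have h1 := expR_ge1Dx v; have h2 := expRxMexpNx_1 v.
have h3 := expR_gt0 (- v).
by rewrite expr2; nra.
Qed.

(** From [expR (- x) >= 1 - x] one gets [expR x <= 1 / (1 - x)]; the restriction [x <= 1/2] is
    exactly what makes this at most [1 + 2 * x]. *)
Lemma expR_le1D2x {R : realType} (x : R) : 0 <= x <= 2^-1 ->
  expR x <= 1 + 2 * x.
Proof.
move=> /andP[x0 x1]; have h1 := expR_ge1Dx (- x); have h2 := expRxMexpNx_1 x.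
have h3 := expR_gt0 x; have : x <= 1/2 by lra.
by nra.
Qed.

Lemma ler_powR_tangent {R : realType} (p y : R) : 0 < p < 1 -> 0 <= y ->
  y `^ p <= 1 + p * (y - 1).
Proof.
move=> /andP[p0 p1]; rewrite le_eqVlt => /predU1P[<-|y0].
  by rewrite powR0 ?gt_eqF//; lra.
have E : y = y `^ p * y `^ (1 - p).
  by rewrite -powRD ?subrKC ?powRr1 ?ltW// gt_eqF ?implybT.
set g := y `^ p in E *; have g0 : 0 < g by exact: powR_gt0.
(* Weighted AM-GM: [(1-p) y^(-p) + p y^(1-p) >= 1], by [expR x >= 1 + x]. *)
have h1 : 1 - p * ln y <= g^-1.
  by rewrite /g -powRN /powR gt_eqF// mulNr; exact: expR_ge1Dx.
have h2 : 1 + (1 - p) * ln y <= y `^ (1 - p).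
  by rewrite /powR gt_eqF//; exact: expR_ge1Dx.
have h : 1 <= (1 - p) * g^-1 + p * y `^ (1 - p) by nra.
have gV : g * g^-1 = 1 by rewrite divff// gt_eqF.
have : g * 1 <= g * ((1 - p) * g^-1 + p * y `^ (1 - p)) by rewrite ler_pM2l.
by rewrite mulr1 mulrDr mulrCA gV mulr1 mulrCA -E; lra.
Qed.

Lemma ger_powR_quadratic {R : realType} (p y : R) : 0 < p < 1 -> 0 <= y ->
  y + (1 - p) * (y * (1 - y)) <= y `^ p.
Proof.
move=> /andP[p0 p1]; rewrite le_eqVlt => /predU1P[<-|y0].
  by rewrite powR0 ?gt_eqF//; lra.
have -> : y `^ p = y * y `^ (p - 1).
  by rewrite -{2}(powRr1 (ltW y0)) -powRD ?subrKC// gt_eqF ?implybT.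
have h1 : 1 + (p - 1) * ln y <= y `^ (p - 1).
  by rewrite /powR gt_eqF//; exact: expR_ge1Dx.
have h2 : ln y <= y - 1 by have := @le_ln1Dx R (y - 1); rewrite subrKC; apply; lra.
have -> : y + (1 - p) * (y * (1 - y)) = y * (1 + (1 - p) * (1 - y)) by ring.
by rewrite ler_pM2l//; nra.
Qed.

Lemma powR_shift_bounds {R : realType} (a l s : R) :
  0 < a < 1 -> 0 < l -> 0 <= s ->
  a * l `^ (a - 1) * s - (1 - a) * l `^ (a - 2) * s ^+ 2
    <= (s + l) `^ a - l `^ a <= a * l `^ (a - 1) * s.
Proof.
move=> ha l0 s0; have x0 : 0 <= s / l by rewrite divr_ge0// ltW.
have -> : s + l = l * (1 + s / l) by field; rewrite gt_eqF.
rewrite powRM; [|exact: ltW|lra].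
have E k : l `^ (a - k%:R) = l `^ a * l ^- k.
  rewrite powRD; last by rewrite (gt_eqF l0) implybT.
  by rewrite powRN powR_mulrn// ltW.
rewrite (E 1%N) (E 2%N).
have y0 : 0 <= 1 + s / l by lra.
have := ler_powR_tangent _ _ ha y0; have := ger_powR_quadratic _ _ ha y0.
have := powR_gt0 a l0; move: (l `^ a) => A A0.
move: ((1 + s / l) `^ a) => B h1 h2.
have -> : a * (A * l ^- 1) * s = A * (a * (s / l)) by field; rewrite gt_eqF.
have -> : (1 - a) * (A * l ^- 2) * s ^+ 2 = A * ((1 - a) * (s / l) ^+ 2) by field; rewrite gt_eqF.
have -> : A * B - A = A * (B - 1) by ring.
rewrite -mulrBr !ler_pM2l//; move: h1 h2; rewrite expr2; move: (s / l) => x h1 h2.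
by apply/andP; split; lra.
Qed.

(** * Bounds on a fractional moment from the Laplace transform *)

Section laplace_moment.
Context {d : measure_display} {T : measurableType d} {R : realType}.
Variable P : probability T R.
Variables (Y : T -> R) (L : R -> R).
Hypothesis mY : measurable_fun setT Y.
Hypothesis Y0 : forall w, 0 <= Y w.
Hypothesis YL : forall u : R, 0 < u -> ('E_P[fun w => expR (- u * Y w)] = (L u)%:E)%E.
Hypothesis L1 : forall u : R, 0 < u -> 1 - L u <= u.

Let mexp u : measurable_fun setT (fun w => expR (- u * Y w)).
Proof. by apply: measurableT_comp => //; exact: measurable_funM. Qed.

Let iexp (u : R) : 0 < u -> P.-integrable setT (EFin \o (fun w => expR (- u * Y w))).
Proof.
move=> u0; apply: measurable_bounded_integrable => //.
  by apply: (le_lt_trans (probability_le1 P measurableT)); rewrite ltry.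
exists 1; split => // M M1 w _ /=; rewrite ger0_norm ?expR_ge0//.
rewrite (le_trans _ (ltW M1))// -expR0 ler_expR mulNr oppr_le0.
by rewrite mulr_ge0// ltW.
Qed.

Let Rexp (u : R) : 0 < u -> \int[P]_w expR (- u * Y w) = L u.
Proof. by move=> u0; rewrite /Rintegral; have := YL _ u0; rewrite unlock => ->. Qed.

Let icst (a : R) : P.-integrable setT (EFin \o (fun _ : T => a)).
Proof. exact: finite_measure_integrable_cst. Qed.

Let iaff (a b u : R) : 0 < u ->
  P.-integrable setT (EFin \o (fun w => a + b * expR (- u * Y w))).
Proof.
move=> u0.
rewrite [X in _.-integrable _ X](_ : _ = (EFin \o (fun=> a)) \+
  (fun w => b%:E * (expR (- u * Y w))%:E))%E.
  by apply: integrableD => //; apply: integrableZl => //; exact: iexp.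
by apply/funext => w /=; rewrite EFinD EFinM.
Qed.

Let Raff (a b u : R) : 0 < u ->
  \int[P]_w (a + b * expR (- u * Y w)) = a + b * L u.
Proof.
move=> u0; rewrite RintegralD//; last first.
  by rewrite [X in _.-integrable _ X](_ : _ = fun w => b%:E * (expR (- u * Y w))%:E)%E//;
    apply: integrableZl => //; exact: iexp.
rewrite Rintegral_cst// RintegralZl//; last exact: iexp.
by rewrite Rexp//= probability_setT mulr1.
Qed.

Let mean_le1 : (\int[P]_w (Y w)%:E <= 1)%E.
Proof.
(* This is [(1 - expR (- h * Y)) / h] with [h = 1 / (n + 1)], expanded to be affine in the
   exponential so that [Raff] computes its mean. *)
pose f n w := (harmonic n)^-1 + (- (harmonic n)^-1) * expR (- harmonic n * Y w).
have h0 n : 0 < harmonic n :> R by exact: harmonic_gt0.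
have fE n w : f n w = (1 - expR (- (harmonic n * Y w))) / harmonic n.
  by rewrite /f -mulNr; field; rewrite gt_eqF.
have f0 n w : 0 <= f n w.
  rewrite fE; apply: divr_ge0; last exact: ltW.
  rewrite subr_ge0 -expR0 ler_expR oppr_le0.
  by rewrite mulr_ge0// ltW.
have mf n : measurable_fun setT (EFin \o f n).
  apply/measurable_EFinP; apply: measurable_funD => //.
  by apply: measurable_funM => //; exact: mexp.
have fY w : (f n w)%:E @[n --> \oo] --> (Y w)%:E.
  apply: cvg_EFin; first exact: nearW.
  (* Pointwise, [f n w] lies between [Y - h * Y ^+ 2] and [Y]. *)
  have : (Y w - harmonic n * Y w ^+ 2) @[n --> \oo] --> Y w - 0 * Y w ^+ 2.
    apply: cvgB; first exact: cvg_cst.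
    by apply: cvgMr_tmp; exact: cvg_harmonic.
  rewrite mul0r subr0 => lf.
  apply: (squeeze_cvgr _ lf (cvg_cst (Y w))); apply: nearW => n.
  rewrite -[(_ \o _) n]/(f n w) fE; move: (harmonic n) (h0 n) => h hp.
  rewrite ler_pdivlMr// ler_pdivrMr// [Y w * _]mulrC oneBexpRN_le andbT.
  have hY0 : 0 <= h * Y w by rewrite mulr_ge0// ltW.
  apply: le_trans (oneBexpRN_ge _ hY0).
  by rewrite le_eqVlt; apply/orP; left; apply/eqP; ring.
have -> : (\int[P]_w (Y w)%:E = \int[P]_w limn_einf (fun n => (EFin \o f n) w))%E.
  by apply: eq_integral => w _; rewrite (cvg_limn_einf_sup (fY w)).
apply: (le_trans (fatou _ _ mf _)) => // [n w _|]; first by rewrite lee_fin.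
(* Each tail infimum is at most its first term, whose integral is [(1 - L h) / h <= 1]. *)
rewrite limn_einf_lim; apply: lime_le; first exact: is_cvg_einfs.
apply: nearW => n; apply: (@le_trans _ _ (\int[P]_w (EFin \o f n) w)%E).
  by apply: ereal_inf_lbound; exists n => /=.
have -> : (\int[P]_w (EFin \o f n) w = (\int[P]_w f n w)%:E)%E.
  by rewrite /Rintegral fineK// integrable_fin_num//; exact: iaff.
rewrite Raff// lee_fin mulNr -[X in X - _]mulr1 -mulrBr mulrC ler_pdivrMr//.
by rewrite mul1r L1.
Qed.

Variables (p : R).
Hypothesis hp : 0 < p < 1.

Let mpow : measurable_fun setT (fun w => Y w `^ p).
Proof. exact: (measurableT_comp (measurable_powR p) mY). Qed.

Lemma moment_le1 : (moment P p Y <= 1)%E.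
Proof.
have /andP[p0 p1] := hp.
have mYE : measurable_fun setT (EFin \o Y) by exact/measurable_EFinP.
have Y0E w : setT w -> (0 <= (Y w)%:E)%E by rewrite lee_fin.
rewrite /moment unlock.
(* The tangent bound is regrouped so that both summands are nonnegative, which allows splitting the
   integral from signs and measurability alone. *)
apply: (@le_trans _ _ (\int[P]_w ((1 - p)%:E + p%:E * (Y w)%:E))%E).
  apply: ge0_le_integral => //.
  - by move=> w _; rewrite lee_fin powR_ge0.
  - exact/measurable_EFinP.
  - by apply: emeasurable_funD => //; exact: measurable_funeM.
  - move=> w _; rewrite -EFinM -EFinD lee_fin.
    by apply: (le_trans (ler_powR_tangent _ _ hp (Y0 w))); lra.
rewrite ge0_integralD//.
- rewrite ge0_integralZl//; last by rewrite lee_fin ltW.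
  rewrite integral_cst//= probability_setT mule1.
  apply: (@le_trans _ _ ((1 - p)%:E + p%:E * 1)%E).
    by rewrite leeD2l// lee_pmul2l ?lte_fin.
  by rewrite mule1 -EFinD subrK.
- by move=> w _; rewrite lee_fin subr_ge0 ltW.
- by move=> w _; rewrite mule_ge0// lee_fin// ltW.
- exact: measurable_funeM.
Qed.

Lemma moment_ge (u : R) : 0 < u ->
  ((((2 - p) * (u * (1 - L u)) - (1 - p) * (1 - 2 * L u + L (2 * u))) / u ^+ 2)%:E
    <= moment P p Y)%E.
Proof.
move=> u0; have u20 : 0 < 2 * u by lra.
have ipow : P.-integrable setT (EFin \o (fun w => Y w `^ p)).
  apply/integrableP; split; first exact/measurable_EFinP.
  under eq_integral do rewrite /= ger0_norm ?powR_ge0//.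
  by have := moment_le1; rewrite /moment unlock => /le_lt_trans; apply; rewrite ltry.
have -> : moment P p Y = (\int[P]_w (Y w `^ p))%:E.
  by rewrite /moment unlock /Rintegral fineK// integrable_fin_num.
rewrite lee_fin.
(* Coefficients of [1], [e] and [e ^+ 2] in that minorant, where [e = expR (- u * Y)]; the mean of
   [e ^+ 2] is [L (2 * u)]. *)
pose a := ((2 - p) * u - (1 - p)) / u ^+ 2.
pose b := (2 * (1 - p) - (2 - p) * u) / u ^+ 2.
pose c := - (1 - p) / u ^+ 2.
have -> : ((2 - p) * (u * (1 - L u)) - (1 - p) * (1 - 2 * L u + L (2 * u))) / u ^+ 2
    = (a + b * L u) + (0 + c * L (2 * u)).
  by rewrite /a /b /c; field; rewrite gt_eqF.
rewrite -!Raff// -RintegralD//; [|exact: iaff..].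
apply: le_Rintegral => //.
  rewrite [X in _.-integrable _ X](_ : _ =
    (EFin \o (fun w => (a + b * expR (- u * Y w))%R)) \+
    (EFin \o (fun w => (0 + c * expR (- (2 * u) * Y w))%R)))%E.
    by apply: integrableD => //; exact: iaff.
  by apply/funext => w /=; rewrite EFinD.
move=> w _.
have -> : expR (- (2 * u) * Y w) = expR (- u * Y w) ^+ 2.
  by rewrite expr2 -expRD; congr expR; ring.
rewrite mulNr; set e := expR _.
have e1 : e <= 1 by rewrite -expR0 ler_expR oppr_le0 mulr_ge0// ltW.
pose z := (1 - e) / u.
have z0 : 0 <= z by rewrite divr_ge0 ?subr_ge0// ltW.
have zY : z <= Y w by rewrite ler_pdivrMr// mulrC oneBexpRN_le.
apply: (@le_trans _ _ (z `^ p)); last first.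
  by rewrite ge0_ler_powR ?nnegrE//; case/andP: hp => /ltW.
apply: le_trans (ger_powR_quadratic _ _ hp z0).
by rewrite le_eqVlt; apply/orP; left; apply/eqP; rewrite /a /b /c /z; field; rewrite gt_eqF.
Qed.

End laplace_moment.

(** * Quantitative estimates for the normalized moment *)

(** Meant for [u = 1 / t], [k = K / m ^+ 2], [L1 = L u] and [L2 = L (2 * u)]: the quadratic error of
    the exponent then becomes cubic in [u], so after division by [u ^+ 2] only an error of order [u]
    remains. *)
Lemma laplace_quotient_ge {R : realType} (p k u L1 L2 : R) :
  0 < p < 1 -> 0 <= k -> 0 < u <= 1 -> k * u <= 8^-1 ->
  expR (- u) <= L1 -> L1 <= expR (- (u - k * u ^+ 3)) ->
  L2 <= expR (- (2 * u) + 4 * k * u ^+ 3) ->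
  1 - (2 + 10 * k) * u
    <= ((2 - p) * (u * (1 - L1)) - (1 - p) * (1 - 2 * L1 + L2)) / u ^+ 2.
Proof.
move=> /andP[p0 p1] k0 /andP[u0 u1] ku1 L1ge L1le L2le.
have u2 : 0 < u ^+ 2 by rewrite exprn_gt0.
have ku : 0 <= k * u by rewrite mulr_ge0// ltW.
have u3 : k * u ^+ 3 = k * u * u ^+ 2 by ring.
have ku2 : k * u * u ^+ 2 <= k * u * u by rewrite ler_wpM2l// expr2; nra.
have ku20 : 0 <= k * u * u ^+ 2 by rewrite mulr_ge0// ltW.
have v0 : 0 <= u - k * u ^+ 3 by rewrite u3; nra.
have h1 : u * (1 - u - k * u) <= 1 - L1.
  have := oneBexpRN_ge _ v0.
  have : (u - k * u ^+ 3) ^+ 2 <= u ^+ 2.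
    by rewrite ler_sqr ?nnegrE ?(ltW u0)// u3; lra.
  by move: L1le; rewrite u3 expr2; lra.
have h2 : 1 - 2 * L1 + L2 <= u ^+ 2 * (1 + 8 * k * u).
  (* For a Laplace transform, [L2 - L1 ^+ 2] is the variance of [expR (- u * Y)]. The square
     contributes at most [u ^+ 2], the variance at most [8 * k * u ^+ 3]. *)
  have -> : 1 - 2 * L1 + L2 = (1 - L1) ^+ 2 + (L2 - L1 ^+ 2) by ring.
  have e1 : expR (- u) <= 1 by rewrite -expR0 ler_expR; lra.
  have L1le1 : 1 - L1 <= u by have := oneBexpRN_le u; lra.
  have L1le1' : L1 <= 1.
    by apply: (le_trans L1le); rewrite -expR0 ler_expR; lra.
  have a1 : (1 - L1) ^+ 2 <= u ^+ 2 by rewrite ler_sqr ?nnegrE//; lra.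
  have a2 : expR (- u) ^+ 2 <= L1 ^+ 2.
    by rewrite ler_sqr ?nnegrE ?expR_ge0// (le_trans _ L1ge) ?expR_ge0.
  have E2 : expR (- (2 * u)) = expR (- u) ^+ 2.
    by rewrite expr2 -expRD; congr expR; ring.
  have a3 : expR (- (2 * u) + 4 * k * u ^+ 3) <=
      expR (- u) ^+ 2 * (1 + 2 * (4 * (k * u ^+ 3))).
    (* The hypothesis [k * u <= 1/8] keeps [4 * k * u ^+ 3] below [1/2], as [expR_le1D2x]
       demands. *)
    rewrite expRD E2 ler_wpM2l ?exprn_ge0 ?expR_ge0// -mulrA expR_le1D2x//.
    by rewrite u3; apply/andP; split; nra.
  have a4 : expR (- u) ^+ 2 <= 1 by rewrite expr_le1// expR_ge0.
  have a5 : expR (- u) ^+ 2 * (8 * (k * u * u ^+ 2)) <= 1 * (8 * (k * u * u ^+ 2)).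
    by rewrite ler_wpM2r// mulr_ge0.
  by move: a3; rewrite u3; lra.
rewrite ler_pdivlMr//.
have h3 : (2 - p) * (u ^+ 2 * (1 - u - k * u)) <= (2 - p) * (u * (1 - L1)).
  rewrite ler_wpM2l//; first lra.
  by rewrite expr2 -mulrA ler_wpM2l// ltW.
have h4 : (1 - p) * (1 - 2 * L1 + L2) <= (1 - p) * (u ^+ 2 * (1 + 8 * k * u)).
  by rewrite ler_wpM2l//; lra.
(* The constants come from [2 - p <= 2] and [(2 - p) + 8 * (1 - p) <= 10]. *)
apply: (@le_trans _ _ (u ^+ 2 * ((2 - p) * (1 - u - k * u) - (1 - p) * (1 + 8 * k * u)))).
  by rewrite mulrC ler_wpM2l ?(ltW u2)//; nra.
by lra.
Qed.

Lemma MTSS_exponent_bounds {R : realType} (a1 l1 a2 l2 c1 c2 : R) :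
  0 < a1 < 1 -> 0 < a2 < 1 -> 0 < l1 -> 0 < l2 -> 0 <= c1 -> 0 <= c2 ->
  let m := c1 * a1 * l1 `^ (a1 - 1) + c2 * a2 * l2 `^ (a2 - 1) in
  exists2 K, 0 <= K & forall s, 0 <= s -> m * s - K * s ^+ 2
    <= c1 * ((s + l1) `^ a1 - l1 `^ a1) + c2 * ((s + l2) `^ a2 - l2 `^ a2)
    <= m * s.
Proof.
move=> ha1 ha2 l10 l20 c10 c20 m.
(* [K] mixes the two quadratic coefficients of [powR_shift_bounds] with weights [c1] and [c2]. *)
exists (c1 * ((1 - a1) * l1 `^ (a1 - 2)) + c2 * ((1 - a2) * l2 `^ (a2 - 2))).
  by case/andP: ha1 => _ ?; case/andP: ha2 => _ ?;
    rewrite addr_ge0// mulr_ge0// mulr_ge0 ?powR_ge0// subr_ge0 ltW.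
move=> s s0; have := powR_shift_bounds _ _ _ ha1 l10 s0.
have := powR_shift_bounds _ _ _ ha2 l20 s0.
move=> /andP[A2 B2] /andP[A1 B1].
have := ler_wpM2l c10 A1; have := ler_wpM2l c10 B1.
have := ler_wpM2l c20 A2; have := ler_wpM2l c20 B2.
by rewrite /m => *; apply/andP; split; lra.
Qed.

Lemma normalized_moment_bounds {d : measure_display} {T : measurableType d}
    {R : realType} (P : probability T R) (X : {RV P >-> R}) (phi : R -> R)
    (p m K t : R) :
  0 < p < 1 -> 0 < m -> 0 <= K ->
  (forall s, 0 <= s -> m * s - K * s ^+ 2 <= phi s <= m * s) ->
  1 <= t -> 8 * (K / m ^+ 2) <= t ->
  {ae P, forall w, 0 <= X w} ->
  (forall s, 0 < s -> ('E_P[fun w => expR (- s * X w)] = (expR (- t * phi s))%:E)%E) ->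
  ((1 - (2 + 10 * (K / m ^+ 2)) * t^-1)%:E
    <= moment P p X * ((m `^ p * t `^ p)^-1)%:E <= 1)%E.
Proof.
move=> hp m0 K0 hphi t1 tK X0 XE.
have t0 : 0 < t by lra.
have mt0 : 0 < m * t by rewrite mulr_gt0.
(* [X] is nonnegative only almost surely, whereas the Laplace bounds require it everywhere;
   truncating at 0 leaves the expectations used unchanged ([XZ]). *)
pose Z w := Num.max (X w) 0.
pose Y w := Z w / (m * t).
have mZ : measurable_fun setT Z by exact: measurable_maxr.
have mY : measurable_fun setT Y by exact: measurable_funM.
have Z0 w : 0 <= Z w by rewrite le_max lexx orbT.
have Y0 w : 0 <= Y w by rewrite divr_ge0// ltW.
have XZ (f : R -> R) : measurable_fun setT f -> (forall x, 0 <= f x) ->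
    ('E_P[fun w => f (X w)] = 'E_P[fun w => f (Z w)])%E.
  move=> mf f0; rewrite unlock; apply: ge0_ae_eq_integral => //.
  - by apply/measurable_EFinP; exact: measurableT_comp.
  - by apply/measurable_EFinP; exact: measurableT_comp.
  - by move=> w _; rewrite lee_fin.
  - by move=> w _; rewrite lee_fin.
  - by apply: filterS X0 => w Xw _; rewrite /Z (max_idPl Xw).
pose L u := expR (- t * phi (u / (m * t))).
have YL u : 0 < u -> ('E_P[fun w => expR (- u * Y w)] = (L u)%:E)%E.
  move=> u0; rewrite /L -XE ?divr_gt0// (XZ (fun x => expR (- (u / (m * t)) * x))).
  - congr expectation.body; apply/funext => w; congr expR.
    by rewrite /Y; field; rewrite !gt_eqF.
  - by apply: measurableT_comp => //; exact: measurable_funM.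
  - by move=> x; exact: expR_ge0.
(* The exponent bounds at [s = u / (m * t)], multiplied by [t]: the slope [m] normalizes to 1. *)
have phiu u : 0 < u ->
    u - K / m ^+ 2 * u ^+ 2 / t <= t * phi (u / (m * t)) <= u.
  move=> u0; have /hphi/andP[lo hi] : 0 <= u / (m * t) by rewrite divr_ge0// ltW.
  have E1 : u = t * (m * (u / (m * t))) by field; rewrite !gt_eqF.
  have E2 : u - K / m ^+ 2 * u ^+ 2 / t =
      t * (m * (u / (m * t)) - K * (u / (m * t)) ^+ 2) by field; rewrite !gt_eqF.
  by rewrite E2 {5}E1 !ler_pM2l// lo hi.
have Lge u : 0 < u -> expR (- u) <= L u.
  by move=> /phiu/andP[_ hi]; rewrite ler_expR mulNr lerN2.
have L1 u : 0 < u -> 1 - L u <= u.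
  by move=> u0; have := Lge u u0; have := oneBexpRN_le u; lra.
have -> : (moment P p X * ((m `^ p * t `^ p)^-1)%:E = moment P p Y)%E.
  rewrite /moment (XZ (fun x => x `^ p)); [|exact: measurable_powR|by move=> x; exact: powR_ge0].
  rewrite unlock -ge0_integralZr//.
  - apply: eq_integral => w _; rewrite -EFinM; congr EFin.
    rewrite /Y powRM ?invr_ge0 ?(ltW mt0)//; congr (_ * _).
    rewrite -powRM; [|exact: ltW..].
    by rewrite -(powR_inv1 (ltW mt0)) -powRrM mulN1r powRN.
  - by apply/measurable_EFinP; exact: (measurableT_comp (measurable_powR p)).
  - by move=> w _; rewrite lee_fin powR_ge0.
  - by rewrite lee_fin invr_ge0 mulr_ge0 ?powR_ge0.
apply/andP; split; last exact: (moment_le1 P Y L mY Y0 YL L1 p hp).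
(* At [u = t^-1] the error [k * u ^+ 2 / t] is [k * u ^+ 3]; [t1] and [tK] become [u <= 1] and
   [k * u <= 1/8]. *)
have u0 : 0 < t^-1 by rewrite invr_gt0.
apply: le_trans (moment_ge P Y L mY Y0 YL L1 p hp _ u0).
rewrite lee_fin; apply: laplace_quotient_ge => //.
- by rewrite divr_ge0// exprn_ge0// ltW.
- by rewrite u0 invf_le1.
- by rewrite ler_pdivrMr//; lra.
- exact: Lge.
- rewrite ler_expR mulNr lerN2; have /andP[+ _] := phiu _ u0.
  by apply: le_trans; rewrite le_eqVlt; apply/orP; left; apply/eqP; ring.
- have /phiu/andP[+ _] : 0 < 2 * t^-1 by lra.
  rewrite ler_expR mulNr => h; rewrite -lerN2 opprK; apply: le_trans h.
  by rewrite le_eqVlt; apply/orP; left; apply/eqP; ring.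
Qed.

(** * Passage to the limit by squeezing *)

Theorem proposition3p3 (R : realType) (d : measure_display)
    (T : measurableType d) (P : probability T R)
    (alpha1 lambda1 alpha2 lambda2 c1 c2 : R) (S : R -> {RV P >-> R})
    (halpha1 : 0 < alpha1 < 1) (halpha2 : 0 < alpha2 < 1)
    (hlambda1 : 0 < lambda1) (hlambda2 : 0 < lambda2)
    (hc1 : 0 <= c1) (hc2 : 0 <= c2) (hc : c1 + c2 = 1)
    (hS : MTSS alpha1 lambda1 alpha2 lambda2 c1 c2 S) :
  forall p : R, 0 < p < 1 ->
    asymp_equiv (fun t => moment P p (S t))
      (fun t => (c1 * alpha1 * lambda1 `^ (alpha1 - 1) +
                 c2 * alpha2 * lambda2 `^ (alpha2 - 1)) `^ p * t `^ p).
Proof.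
move=> p hp; case: hS => -[levyS incS] ES.
have [K K0] := MTSS_exponent_bounds _ _ _ _ _ _ halpha1 halpha2 hlambda1 hlambda2 hc1 hc2.
set m := c1 * alpha1 * _ + _ => hphi.
(* The weights sum to 1, so at least one of the two nonnegative terms is positive. *)
have m0 : 0 < m.
  have A1 : 0 < alpha1 * lambda1 `^ (alpha1 - 1).
    by rewrite mulr_gt0 ?powR_gt0//; case/andP: halpha1.
  have A2 : 0 < alpha2 * lambda2 `^ (alpha2 - 1).
    by rewrite mulr_gt0 ?powR_gt0//; case/andP: halpha2.
  rewrite /m -!mulrA; have [c10|c10] := ltP 0 c1.
    by apply: ltr_pwDl; [exact: mulr_gt0|rewrite mulr_ge0// ltW].
  have -> : c1 = 0 by lra.
  by rewrite mul0r add0r mulr_gt0//; lra.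
have low : (1 - (2 + 10 * (K / m ^+ 2)) * t^-1)%:E @[t --> +oo] --> 1%:E.
  apply: cvg_EFin; first exact: nearW.
  rewrite -[X in _ --> X]subr0 -[X in _ - X](mulr0 (2 + 10 * (K / m ^+ 2))).
  apply: cvgB; first exact: cvg_cst.
  apply: cvgMl_tmp; apply/cvgrVy; first by near=> t; rewrite invr_gt0.
  by rewrite /unstable.inv_fun; under eq_fun do rewrite invrK; exact: cvg_id.
apply: (squeeze_cvge _ low (cvg_cst 1%E)).
near=> t.
have t1 : 1 <= t by near: t; exact: nbhs_pinfty_ge.
have tK : 8 * (K / m ^+ 2) <= t by near: t; apply: nbhs_pinfty_ge; exact: num_real.
have t0 : 0 <= t by lra.
apply: normalized_moment_bounds hp m0 K0 hphi t1 tK _ _.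
  (* Almost sure nonnegativity of [S t] comes from monotonicity between times 0 and [t] and the
     start at 0. *)
  have := incS 0 t (lexx 0) t0; have := levy_start0 levyS.
  by apply: filterS2 => w -> .
by move=> s s0; exact: ES.
Unshelve. all: by end_near.
Qed.
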